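(* Let $d\ge 1$ and $K\ge 2$ be integers. There exists a constant $C(d,K)>0$ depending only on $d$ and $K$ such that for every integer $n\ge 1$ and every function $f:\Omega_K^n\to\mathbf{C}$ with $\deg(f)\le d$, $$\|\widehat f\|_{\frac{2d}{d+1}}\le C(d,K)\,\|f\|_{\Omega_K^n}.$$
   Context: $\Omega_K=\{1,\omega_K,\dots,\omega_K^{K-1}\}$ with $\omega_K=e^{2\pi i/K}$ is the multiplicative cyclic group of order $K$. Every function $f:\Omega_K^n\to\mathbf{C}$ has a unique Fourier expansion $f(z)=\sum_{\alpha\in\{0,1,\dots,K-1\}^n}\widehat f(\alpha)z^\alpha$ with $\widehat f(\alpha)\in\mathbf{C}$, where $z^\alpha=\prod_j z_j^{\alpha_j}$; its degree $\deg(f)$ is the degree of this polynomial, so $\deg(f)\le d$ means $\widehat f(\alpha)=0$ whenever $|\alpha|:=\sum_j\alpha_j>d$. For $p>0$, $\|\widehat f\|_p:=\big(\sum_\alpha|\widehat f(\alpha)|^p\big)^{1/p}$. For a set $X$, $\|f\|_X:=\sup_{x\in X}|f(x)|$. *)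

(* Defs.v *)
From mathcomp Require Import all_boot all_order all_algebra.
From mathcomp Require Import all_classical all_reals all_analysis.
From mathcomp Require Import complex.

Set Implicit Arguments.
Unset Strict Implicit.
Unset Printing Implicit Defensive.
Import Order.TTheory GRing.Theory Num.Theory.
Import ComplexField.Normc.
Local Open Scope classical_set_scope.
Local Open Scope ring_scope.
Local Open Scope complex_scope.

(* exp (2 i pi / K), as cos + i sin *)
Definition omega (R : realType) (K : nat) : R[i] :=
  cos (2 * pi / K%:R) +i* sin (2 * pi / K%:R).

Definition Omega_seq (R : realType) (K : nat) : seq R[i] :=
  [seq omega R K ^+ j | j <- iota 0 K].

(* Omega R K is the finite subtype of R[i] whose elements are the powers
   omega ^+ j, j < K; val : Omega R K -> R[i] is the inclusion. *)
Notation Omega R K := (seq_sub (Omega_seq R K)).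
Notation cube R K n := {ffun 'I_n -> Omega R K}.
Notation mindex K n := {ffun 'I_n -> 'I_K}.

Definition mabs (K n : nat) (a : mindex K n) : nat := (\sum_(j < n) a j)%N.

Definition monom (R : realType) (K n : nat) (z : cube R K n)
    (a : mindex K n) : R[i] :=
  \prod_(j < n) val (z j) ^+ a j.

Definition is_fourier_expansion (R : realType) (K n : nat)
    (f : cube R K n -> R[i]) (c : {ffun mindex K n -> R[i]}) : Prop :=
  forall z, f z = \sum_a c a * monom z a.

(* The coefficients of the Fourier expansion of f. By fourierP and fourier_uniq
   below the expansion exists and is unique for K > 0, so the default value 0
   is never used. *)
Definition fourier (R : realType) (K n : nat) (f : cube R K n -> R[i]) :
    {ffun mindex K n -> R[i]} :=
  xget 0 [set c | is_fourier_expansion f c].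

(* The zero function gets degree 0. *)
Definition fdeg (R : realType) (K n : nat) (f : cube R K n -> R[i]) : nat :=
  (\max_(a | fourier f a != 0%R) mabs a)%N.

Definition lpnorm (R : realType) (I : finType) (p : R) (c : I -> R[i]) : R :=
  (\sum_i normc (c i) `^ p) `^ p^-1.

Definition supnorm (R : realType) (X : Type) (f : X -> R[i]) : R :=
  sup (range (fun x => normc (f x))).

Lemma omegaX (R : realType) (K j : nat) :
  omega R K ^+ j =
  cos (2 * pi / K%:R * j%:R) +i* sin (2 * pi / K%:R * j%:R).
Proof.
elim: j => [|j IH]; first by rewrite expr0 mulr0 cos0 sin0.
rewrite exprS IH /omega -[j.+1%:R]natr1 (mulrDr (2 * pi / _)) mulr1 addrC cosD sinD.
by apply/eqP; rewrite eq_complex /= eqxx addrC eqxx.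
Qed.

Lemma omega_prim (R : realType) (K : nat) :
  (0 < K)%N -> K.-primitive_root (omega R K).
Proof.
move=> K0; rewrite /primitive_root_of_unity K0; apply/forallP => i.
have KR : (0 : R) < K%:R by rewrite ltr0n.
rewrite unity_rootE omegaX; have := ltn_ord i; rewrite leq_eqVlt => /orP[].
  move=> iK; rewrite iK (eqP iK) (mulfVK (lt0r_neq0 KR)) mulr_natl.
  by rewrite cos2pi sin2pi; apply/eqP/eqP.
move=> iK; rewrite (ltn_eqF iK) eqbF_neg eq_complex /= negb_and.
apply/orP; left.
set t : R := pi / K%:R * i.+1%:R.
have -> : 2 * pi / K%:R * i.+1%:R = t *+ 2.
  by rewrite /t -[RHS]mulr_natl !mulrA.
rewrite cos_mulr2n.
have t0 : 0 < sin t.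
  apply: sin_gt0_pi; apply/andP; split.
    by rewrite !mulr_gt0 ?pi_gt0 ?invr_gt0 ?ltr0n.
  rewrite /t mulrAC ltr_pdivrMr// ltr_pM2l ?pi_gt0//.
  by rewrite ltr_nat.
rewrite cos2sin2 mulrnBl addrAC (_ : 1 *+ 2 - 1 = 1); last first.
  by rewrite mulr2n addrK.
rewrite -subr_eq0 addrAC subrr add0r oppr_eq0 mulrn_eq0/=.
by rewrite expf_eq0/= gt_eqF.
Qed.

Lemma omega_neq0 (R : realType) (K : nat) : (0 < K)%N -> omega R K != 0.
Proof.
move=> K0; have := prim_expr_order (omega_prim R K0).
case: eqP => // -> /esym/eqP; rewrite expr0n (gtn_eqF K0).
by rewrite oner_eq0.
Qed.

Lemma Omega_seq_uniq (R : realType) (K : nat) : uniq (Omega_seq R K).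
Proof.
case: (posnP K) => [->//|K0]; rewrite map_inj_in_uniq ?iota_uniq// => x y.
rewrite !mem_iota !add0n => /= xK yK /eqP.
by rewrite (eq_prim_root_expr (omega_prim R K0)) !modn_small// => /eqP.
Qed.

Lemma Omega_neq0 (R : realType) (K : nat) (u : Omega R K) : val u != 0.
Proof.
case: u => x /= /mapP[j]; rewrite mem_iota add0n => /= jK ->.
have K0 : (0 < K)%N by exact: leq_ltn_trans jK.
by rewrite expf_neq0// omega_neq0.
Qed.

Lemma OmegaX1 (R : realType) (K : nat) (u : Omega R K) : val u ^+ K = 1.
Proof.
case: u => x /= /mapP[j]; rewrite mem_iota add0n => /= jK ->.
have K0 : (0 < K)%N by exact: leq_ltn_trans jK.
by rewrite exprAC (prim_expr_order (omega_prim R K0)) expr1n.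
Qed.

Lemma sum_Omega (R : realType) (K : nat) (F : R[i] -> R[i]) :
  \sum_(u : Omega R K) F (val u) = \sum_(j < K) F (omega R K ^+ j).
Proof.
rewrite -(big_mkord xpredT (fun j => F (omega R K ^+ j))).
rewrite /index_iota subn0 -(big_map (fun j => omega R K ^+ j) xpredT F).
rewrite -(big_map val xpredT F); apply: perm_big; apply: uniq_perm.
- by rewrite map_inj_uniq ?index_enum_uniq//; exact: val_inj.
- exact: Omega_seq_uniq.
move=> x; apply/mapP/idP => [[u _ ->]|xO]; first exact: valP.
by exists (SeqSub xO); rewrite ?mem_index_enum.
Qed.

Lemma sum_expr_root1 (F : fieldType) (K : nat) (q : F) : q ^+ K = 1 ->
  \sum_(j < K) q ^+ j = if q == 1 then K%:R else 0.
Proof.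
move=> qK; case: eqVneq => [->|q1].
  by under eq_bigr do rewrite expr1n; rewrite sumr_const card_ord.
apply: (mulfI (_ : q - 1 != 0)); first by rewrite subr_eq0.
by rewrite -subrX1 qK subrr mulr0.
Qed.

Lemma sum_Omega_expr (R : realType) (K : nat) (k l : 'I_K) :
  \sum_(u : Omega R K) val u ^+ k / val u ^+ l =
  if k == l then K%:R else 0.
Proof.
have K0 : (0 < K)%N by exact: leq_ltn_trans (ltn_ord k).
have wp := omega_prim R K0; set w := omega R K in wp.
rewrite (sum_Omega K (fun x => x ^+ k / x ^+ l)) -/w.
under eq_bigr => j _ do
  rewrite (exprAC w) (exprAC w _ l) -exprVn -exprMn.
rewrite sum_expr_root1; last first.
  by rewrite exprMn exprVn (exprAC w) (exprAC w l) (prim_expr_order wp)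
    !expr1n divr1.
have wl : w ^+ l != 0 by rewrite expf_neq0// omega_neq0.
rewrite -(inj_eq (mulIf wl)) mulfVK// mul1r (eq_prim_root_expr wp).
by rewrite !modn_small.
Qed.

Lemma sum_ord_expr (R : realType) (K : nat) (u v : Omega R K) :
  \sum_(k < K) val u ^+ k / val v ^+ k = if u == v then K%:R else 0.
Proof.
under eq_bigr do rewrite -exprVn -exprMn.
rewrite sum_expr_root1; last by rewrite exprMn exprVn !OmegaX1 divr1.
by rewrite -(inj_eq (mulIf (Omega_neq0 v))) mulfVK ?Omega_neq0// mul1r.
Qed.

Lemma sum_cube_monom (R : realType) (K n : nat) (a b : mindex K n) :
  \sum_(z : cube R K n) monom z a / monom z b =
  if a == b then K%:R ^+ n else 0.
Proof.
under eq_bigr do rewrite -prodf_div.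
rewrite -(bigA_distr_bigA (fun j u => val u ^+ a j / val u ^+ b j)).
under eq_bigr do rewrite sum_Omega_expr.
case: eqVneq => [->|ab].
  by under eq_bigr do rewrite eqxx; rewrite prodr_const card_ord.
have [j ajb] : exists j, a j != b j.
  by apply/existsP; rewrite -negb_forall; apply: contra ab => /forallP h;
    apply/eqP/ffunP => j; exact/eqP.
by rewrite (bigD1 j)//= (negbTE ajb) mul0r.
Qed.

Lemma sum_mindex_monom (R : realType) (K n : nat) (w z : cube R K n) :
  \sum_(a : mindex K n) monom w a / monom z a =
  if w == z then K%:R ^+ n else 0.
Proof.
under eq_bigr do rewrite -prodf_div.
rewrite -(bigA_distr_bigA (fun j k => val (w j) ^+ nat_of_ord k / val (z j) ^+ k)).
under eq_bigr do rewrite sum_ord_expr.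
case: eqVneq => [->|wz].
  by under eq_bigr do rewrite eqxx; rewrite prodr_const card_ord.
have [j wjz] : exists j, w j != z j.
  by apply/existsP; rewrite -negb_forall; apply: contra wz => /forallP h;
    apply/eqP/ffunP => j; exact/eqP.
by rewrite (bigD1 j)//= (negbTE wjz) mul0r.
Qed.

Lemma fourier_expansionE (R : realType) (K n : nat) (f : cube R K n -> R[i])
    (c : {ffun mindex K n -> R[i]}) : (0 < K)%N ->
  is_fourier_expansion f c <->
  c = [ffun a => (\sum_z f z / monom z a) / K%:R ^+ n].
Proof.
move=> K0; have Kn : K%:R ^+ n != 0 :> R[i].
  by rewrite expf_neq0// pnatr_eq0 -lt0n.
split=> [fc|-> w].
  apply/ffunP => b; rewrite ffunE.
  under eq_bigr do rewrite fc mulr_suml.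
  rewrite exchange_big /=.
  under eq_bigr => a _ do
    (under eq_bigr do rewrite -mulrA; rewrite -mulr_sumr sum_cube_monom).
  rewrite (bigD1 b)//= eqxx big1 ?addr0 ?mulfK// => a /negbTE ->.
  by rewrite mulr0.
under eq_bigr => a _ do rewrite ffunE -mulrA [_^-1 * _]mulrC mulrA mulr_suml.
rewrite -mulr_suml exchange_big /=.
under eq_bigr => z _ do
  (under eq_bigr do rewrite -mulrA [_^-1 * _]mulrC;
   rewrite -mulr_sumr sum_mindex_monom).
rewrite (bigD1 w)//= eqxx big1 ?addr0 ?mulfK// => z.
by rewrite eq_sym => /negbTE ->; rewrite mulr0.
Qed.

Lemma fourierP (R : realType) (K n : nat) (f : cube R K n -> R[i]) :
  (0 < K)%N -> is_fourier_expansion f (fourier f).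
Proof.
move=> K0; rewrite /fourier; case: xgetP => [c _ //|/= h]; exfalso.
apply: (h [ffun a => (\sum_z f z / monom z a) / K%:R ^+ n]).
exact/(fourier_expansionE f _ K0).
Qed.

Lemma fourier_uniq (R : realType) (K n : nat) (f : cube R K n -> R[i])
    (c : {ffun mindex K n -> R[i]}) :
  (0 < K)%N -> is_fourier_expansion f c -> c = fourier f.
Proof.
move=> K0 /(fourier_expansionE f _ K0) ->.
by have /(fourier_expansionE f _ K0) <- := fourierP f K0.
Qed.

Lemma fdeg_le (R : realType) (K n d : nat) (f : cube R K n -> R[i]) :
  (fdeg f <= d)%N <-> forall a, (d < mabs a)%N -> fourier f a = 0.
Proof.
split=> [/bigmax_leqP h a da|h].
  by apply: contraTeq da => /h; rewrite leqNgt.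
by apply/bigmax_leqP => a; apply: contraNT; rewrite -ltnNge => /h ->.
Qed.

Lemma supnorm_max (R : realType) (K n : nat) (f : cube R K n -> R[i]) :
  (0 < K)%N ->
  (forall z, normc (f z) <= supnorm f) /\
  exists z, supnorm f = normc (f z).
Proof.
move=> K0; have w0 : 1 \in Omega_seq R K.
  by apply/mapP; exists 0%N; rewrite ?mem_iota ?expr0.
pose z1 : cube R K n := [ffun=> SeqSub w0].
pose z0 := [arg max_(z > z1) normc (f z)]%O.
have z0P z : normc (f z) <= normc (f z0).
  by rewrite /z0; case: Order.TotalTheory.arg_maxP => // y _; exact.
have ub0 : ubound (range (fun z => normc (f z))) (normc (f z0)).
  by move=> _ [z _ <-].
have supE : supnorm f = normc (f z0).
  apply/eqP; rewrite eq_le; apply/andP; split.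
    by apply: ge_sup => //; exists (normc (f z1)), z1.
  by apply: ub_le_sup; [exists (normc (f z0))|exists z0].
by split; [move=> z; rewrite supE|exists z0].
Qed.

(* Main.v *)
(* Write c for the Fourier coefficients of f and N for its supremum norm; f(rho)
   denotes the multi-affine extension of f to products of measures rho_j of
   total mass 1. It is bounded by N when the rho_j are positive, in particular
   near the uniform measure. Along a line through the uniform measure f(rho) is
   a polynomial of degree at most d, so its values elsewhere and its derivatives
   are bounded by N up to a constant depending only on d and K. Differentiating
   at the point mass z in the directions u_j conj(x_j)^k, with unimodular u_j, gives
     sum_j |D_{j,k} f(z)| <= C N,
   where D_{j,k} f is the coefficient of z_j^k in f. Hypercontractivity bounds
   the L2 norm of D_{j,k} f by its L1 norm, hence
     sum_{j, k <> 0} (sum_{a_j = k} |c_a|^2)^(1/2) <= C' N.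
   Finally, let g_{j,k} be the summands on the left, scaled so that their sum is
   at most 1. The arithmetic-geometric mean inequality bounds |c_a|^(2d/(d+1)) by
   the sum over j in supp a of |c_a|^2 / g_{j,a_j}, plus the product over supp a
   of g_{j,a_j}. Summed over a, the first term is at most 1 and the second is at
   most prod_j (1 + sum_k g_{j,k}) <= e. *)

Require Import Defs.
From mathcomp Require Import all_boot all_order all_algebra.
From mathcomp Require Import all_classical all_reals all_analysis.
From mathcomp Require Import complex.
From mathcomp Require Import ring lra.
Import Order.TTheory GRing.Theory Num.Theory.
Import ComplexField.Normc.
Local Open Scope ring_scope.
Local Open Scope complex_scope.

Set Implicit Arguments.
Unset Strict Implicit.
Unset Printing Implicit Defensive.

Local Notation Re := (@complex.Re _).
Local Notation Im := (@complex.Im _).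

(** * The modulus of complex numbers *)

Section NormC.
Variable R : realType.
Implicit Types x y : R[i].

Lemma sqr_normcE x : normc x ^+ 2 = Re x ^+ 2 + Im x ^+ 2.
Proof. by case: x => a b; rewrite /normc sqr_sqrtr// addr_ge0 ?sqr_ge0. Qed.

Lemma normc_ge0 x : 0 <= normc x.
Proof. by case: x => a b; rewrite sqrtr_ge0. Qed.

Lemma normc_real (r : R) : normc r%:C = `|r|.
Proof. by rewrite /normc /= expr0n addr0 sqrtr_sqr. Qed.

Lemma normc_sum (I : Type) (s : seq I) (P : pred I) (F : I -> R[i]) :
  normc (\sum_(i <- s | P i) F i) <= \sum_(i <- s | P i) normc (F i).
Proof.
elim/big_rec2: _ => [|i r x _ le_xr]; first by rewrite normc0.
by rewrite (le_trans (le_normcD _ _))// lerD2l.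
Qed.

Lemma normc_prod (I : Type) (s : seq I) (P : pred I) (F : I -> R[i]) :
  normc (\prod_(i <- s | P i) F i) = \prod_(i <- s | P i) normc (F i).
Proof. exact: (big_morph _ (@normcM R) (@normc1 R)). Qed.

Lemma normcX x n : normc (x ^+ n) = normc x ^+ n.
Proof. by elim: n => [|n IH]; rewrite ?expr0 ?normc1// !exprS normcM IH. Qed.

Lemma normc_Re_le x : `|Re x| <= normc x.
Proof.
rewrite -ler_sqr ?nnegrE ?normc_ge0// sqr_normcE real_normK ?num_real//.
by rewrite lerDl sqr_ge0.
Qed.

Lemma normc_Im_le x : `|Im x| <= normc x.
Proof.
rewrite -ler_sqr ?nnegrE ?normc_ge0// sqr_normcE real_normK ?num_real//.
by rewrite lerDr sqr_ge0.
Qed.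

(** Such multipliers turn a sum of moduli into a value of a linear form. For x = 0 the witness is 0,
    hence an inequality for the modulus of u. *)
Lemma normc_phase x : exists2 u : R[i], normc u <= 1 & u * x = (normc x)%:C.
Proof.
have [->|x0] := eqVneq x 0; first by exists 0; rewrite ?normc0// mul0r.
have nx0 : normc x != 0 by apply: contra_neq x0 => /eq0_normc.
exists ((normc x)%:C / x); last by rewrite divfK.
by rewrite normcM normcV normc_real ger0_norm ?normc_ge0// divff.
Qed.

Lemma conjc_mul_normc x : x * conjc x = (normc x ^+ 2)%:C.
Proof.
rewrite sqr_normcE; case: x => a b; apply/eqP; rewrite eq_complex /=.
by apply/andP; split; apply/eqP; ring.
Qed.

End NormC.

(** * Inequalities for finite real sums *)

Section RealSums.
Variables (R : realType) (I : finType).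
Implicit Types (P : pred I) (F G : I -> R).

(** With A, B the sums of squares and D the mixed sum, the sum of (A G_i - D F_i)^2 equals A (A B -
    D^2). If A = 0, every F_i vanishes and so does D. *)
Lemma sum_cauchy_schwarz P F G :
  (\sum_(i | P i) F i * G i) ^+ 2 <=
  (\sum_(i | P i) F i ^+ 2) * (\sum_(i | P i) G i ^+ 2).
Proof.
set A := \sum_(i | P i) F i ^+ 2; set B := \sum_(i | P i) G i ^+ 2.
set D := \sum_(i | P i) _.
have A0 : 0 <= A by apply: sumr_ge0 => i _; exact: sqr_ge0.
have B0 : 0 <= B by apply: sumr_ge0 => i _; exact: sqr_ge0.
have H : 0 <= \sum_(i | P i) (A * G i - D * F i) ^+ 2.
  by apply: sumr_ge0 => i _; exact: sqr_ge0.
have ringE (a b c : R) : a ^+ 2 * b - 2 * (a * c) * c + c ^+ 2 * a =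
    a * (a * b - c ^+ 2) by ring.
have ringE2 (a c x y : R) : (a * y - c * x) ^+ 2 =
    a ^+ 2 * y ^+ 2 - 2 * (a * c) * (x * y) + c ^+ 2 * x ^+ 2 by ring.
have HE : \sum_(i | P i) (A * G i - D * F i) ^+ 2 = A * (A * B - D ^+ 2).
  under eq_bigr do rewrite ringE2.
  by rewrite big_split /= sumrB -!mulr_sumr ringE.
move: H; rewrite HE; have [A1|A1] := ltP 0 A.
  by rewrite pmulr_rge0// subr_ge0.
move=> _; have {A1} AE : A = 0 by apply/eqP; rewrite eq_le A1 A0.
suff -> : D = 0 by rewrite expr0n mulr_ge0.
rewrite /D big1// => i Pi; apply/eqP; rewrite mulf_eq0; apply/orP; left.
rewrite -sqrf_eq0.
have /eqP := AE; rewrite psumr_eq0 => [/allP h|? _]; last exact: sqr_ge0.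
by have /implyP/(_ Pi) := h i (mem_index_enum i).
Qed.

Lemma sqr_sum_le P F :
  (\sum_(i | P i) F i) ^+ 2 <= #|I|%:R * \sum_(i | P i) F i ^+ 2.
Proof.
have := sum_cauchy_schwarz P F (fun=> 1).
under eq_bigr do rewrite mulr1.
move=> /le_trans; apply; rewrite mulrC ler_wpM2r//.
  by apply: sumr_ge0 => i _; exact: sqr_ge0.
under eq_bigr do rewrite expr1n; rewrite sumr_const ler_nat.
exact: max_card.
Qed.

Lemma sum_sqr_le P F : (forall i, P i -> 0 <= F i) ->
  \sum_(i | P i) F i ^+ 2 <= (\sum_(i | P i) F i) ^+ 2.
Proof.
move=> F0; rewrite expr2 mulr_suml; apply: ler_sum => i Pi.
rewrite expr2 ler_wpM2l ?F0// (bigD1 i)//= lerDl.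
by apply: sumr_ge0 => j /andP[/F0].
Qed.

Lemma prod_add1_le_expR P F : (forall i, P i -> 0 <= F i) ->
  \prod_(i | P i) (1 + F i) <= expR (\sum_(i | P i) F i).
Proof.
move=> F0; rewrite expR_sum; apply: ler_prod => i Pi.
by rewrite addr_ge0 ?F0//= expR_ge1Dx.
Qed.

End RealSums.

(** * Coefficients of a polynomial bounded by its values at real points *)

Section CoefBound.
Variable R : realType.

(** Induction on the nodes: p - p(t) is divisible by X - t, the quotient is controlled at the
    remaining nodes, and its coefficients determine those of p. The constant depends on the nodes
    alone. *)
Lemma poly_coef_bound_nodes (s : seq R) : uniq s ->
  exists2 C : R, 0 <= C & forall (p : {poly R[i]}) (M : R), 0 <= M ->
    (size p <= size s)%N -> {in s, forall t : R, normc p.[t%:C] <= M} ->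
    forall i, normc p`_i <= C * M.
Proof.
elim: s => [_|t s IH /= /andP[ts us]].
  exists 0 => // p M _; rewrite leqn0 size_poly_eq0 => /eqP -> _ i.
  by rewrite coef0 normc0 mul0r.
have [C C0 HC] := IH us.
pose e := \sum_(u <- s) `|u - t|^-1.
have e0 : 0 <= e by apply: sumr_ge0 => u _; rewrite invr_ge0.
(* The quotient is at most 2 e M at the remaining nodes, so its coefficients are at most B = 2 C e
   M; those of q (X - t) + p(t) are then at most B + B |t| + M. *)
exists (1 + C * e * 2 * (1 + `|t|)).
  by rewrite addr_ge0// !mulr_ge0// addr_ge0.
move=> p M M0 sp pM i.
have /factor_theorem[q qE] : root (p - p.[t%:C]%:P) t%:C.
  by rewrite rootE !hornerE subrr.
have pE : p = q * ('X - t%:C%:P) + p.[t%:C]%:P by rewrite -qE subrK.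
have [q0|q0] := eqVneq q 0.
  rewrite pE q0 mul0r add0r coefC (le_trans (_ : _ <= M))//.
    by case: ifP; rewrite ?normc0// pM// mem_head.
  by rewrite ler_peMl// lerDl !mulr_ge0// addr_ge0.
have sq : (size q <= size s)%N.
  have sqE : size (q * ('X - t%:C%:P)) = (size q).+1.
    by rewrite size_Mmonic ?monicXsubC// size_XsubC addn2.
  rewrite -ltnS -sqE -qE (leq_trans (size_polyD _ _))// geq_max size_polyN sp.
  by rewrite (leq_trans (size_polyC_leq1 _)).
have qM : {in s, forall u : R, normc q.[u%:C] <= e * (2 * M)}.
  move=> u us'; have ut : u - t != 0.
    by rewrite subr_eq0; apply: contraNneq ts => <-.
  have : q.[u%:C] * (u - t)%:C = p.[u%:C] - p.[t%:C].
    by rewrite [X in X.[u%:C] - _]pE !hornerE /= addrK rmorphB.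
  move=> /(congr1 (@normc R)); rewrite normcM normc_real => h.
  have {}h : normc q.[u%:C] = normc (p.[u%:C] - p.[t%:C]) * `|u - t|^-1.
    by rewrite -h mulfK// normr_eq0.
  rewrite h mulrC ler_pM ?normc_ge0 ?invr_ge0//.
    rewrite /e (big_rem u)//= lerDl; apply: sumr_ge0 => v _.
    by rewrite invr_ge0.
  rewrite (le_trans (le_normcD _ _))// normcN mulr_natl mulr2n.
  by rewrite lerD// pM// ?mem_head// inE us' orbT.
have {}HC := HC q (e * (2 * M)) (mulr_ge0 e0 (mulr_ge0 (ler0n _ 2) M0)) sq qM.
set B := C * _ in HC; have B0 : 0 <= B by rewrite /B !mulr_ge0.
rewrite pE coefD mulrBr coefB coefMX coefMC coefC.
rewrite (_ : (1 + _) * M = (B + B * `|t|) + M); last by rewrite /B; ring.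
rewrite (le_trans (le_normcD _ _))// lerD//.
  rewrite (le_trans (le_normcD _ _))// lerD//.
    by case: ifP => _; rewrite ?normc0.
  by rewrite normcN normcM normc_real ler_wpM2r.
by case: ifP => _; rewrite ?normc0// pM// mem_head.
Qed.

Lemma poly_coef_bound (d : nat) (e : R) : 0 < e ->
  exists2 C : R, 0 <= C & forall (p : {poly R[i]}) (M : R), 0 <= M ->
    (size p <= d.+1)%N -> (forall t : R, `|t| <= e -> normc p.[t%:C] <= M) ->
    forall i, normc p`_i <= C * M.
Proof.
(* The d + 1 nodes are distinct and lie in the interval from 0 to e. *)
move=> e0; pose s : seq R := [seq e / i.+1%:R | i <- iota 0 d.+1].
have us : uniq s.
  rewrite map_inj_uniq ?iota_uniq// => i j.
  move=> /(mulfI (lt0r_neq0 e0))/invr_inj/eqP.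
  by rewrite eqr_nat eqSS => /eqP.
have [C C0 HC] := poly_coef_bound_nodes us.
exists C => // p M M0 sp pM; apply: HC => //.
  by rewrite size_map size_iota.
move=> _ /mapP[i _ ->]; apply: pM.
rewrite ger0_norm ?divr_ge0 ?(ltW e0)// ler_pdivrMr// ler_peMr ?(ltW e0)//.
by rewrite ler1n.
Qed.

End CoefBound.

(* The geometric-mean form of Blei's inequality, weakened from the exponent
   2 m / (m + 1) with m = #|S| to the larger exponent 2 d / (d + 1), which is
   allowed because t <= 1. *)
Lemma powR_le_blei (R : realType) (I : finType) (S : {set I}) (d : nat)
    (t : R) (g : I -> R) :
  0 <= t <= 1 -> (0 < d)%N -> (0 < #|S|)%N -> (#|S| <= d)%N ->
  {in S, forall i, t <= g i} ->
  t `^ ((2 * d)%:R / (d + 1)%:R) <=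
  \sum_(i in S) t ^+ 2 / g i + \prod_(i in S) g i.
Proof.
move=> /andP[t0 t1] d0 S0 Sd tg.
have p0 : (2 * d)%:R / (d + 1)%:R != 0 :> R.
  by rewrite mulf_neq0 ?invr_eq0 ?pnatr_eq0 ?muln_eq0 ?addn1 -?lt0n.
have [->|tn0] := eqVneq t 0.
  rewrite powR0// addr_ge0 ?sumr_ge0 ?prodr_ge0// => i iS.
  - by rewrite expr0n/= mul0r.
  - exact: le_trans (tg _ iS).
have {}t0 : 0 < t by rewrite lt_def tn0.
have g0 i : i \in S -> 0 < g i by move=> /tg; exact: lt_le_trans.
set m := #|S| in S0 Sd.
set s := (X in _ <= X).
have s0 : 0 <= s.
  by rewrite addr_ge0 ?sumr_ge0 ?prodr_ge0// => i /g0 gi; rewrite ?divr_ge0 ?sqr_ge0// ltW.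
(* The arithmetic-geometric mean inequality is applied to m + 1 numbers: the t^2 / g_i, and, at
   [None], the product of the g_i. Their product is t^(2m) because the g_i cancel. *)
pose E (o : option I) : R := if o is Some i then t ^+ 2 / g i else \prod_(i in S) g i.
pose A : {pred option I} := [pred o | if o is Some i then i \in S else true].
have bigA (T : Type) (idx : T) (op : Monoid.com_law idx) (F : option I -> T) :
    \big[op/idx]_(o in A) F o = op (F None) (\big[op/idx]_(i in S) F (Some i)).
  rewrite (bigD1 None)//= (reindex_omap Some id) => [|[]//].
  congr (op _ _); apply: eq_bigl => i.
  by rewrite [Some i == Some i]eqxx !andbT.
have prodE : \prod_(o in A) E o = t ^+ (2 * m).
  rewrite bigA -big_split /= (eq_bigr (fun=> t ^+ 2)); last first.
    by move=> i /g0 gi; rewrite mulrC divfK// gt_eqF.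
  by rewrite prodr_const -exprM.
have sumE : \sum_(o in A) E o = s by rewrite bigA /= addrC.
have cA : #|A| = m.+1 by rewrite -sum1_card bigA /= sum1_card add1n.
have E0 : {in A, forall o, 0 <= E o}.
  move=> [i|] /=; rewrite !inE => h.
    by rewrite divr_ge0 ?sqr_ge0 ?ltW ?g0.
  by apply: prodr_ge0 => i /g0/ltW.
have := leif_AGM E0; rewrite prodE sumE cA => -[h _].
have {}h : t ^+ (2 * m) <= s ^+ m.+1.
  rewrite (le_trans h)// lerXn2r ?nnegrE ?divr_ge0//.
  by rewrite ler_pdivrMr// ler_peMr// ler1n.
have {h} : t `^ ((2 * m)%:R / m.+1%:R) <= s.
  rewrite -(@ler_pXn2r _ m.+1) ?nnegrE ?powR_ge0//.
  rewrite -powR_mulrn ?powR_ge0// -powRrM divfK ?pnatr_eq0//.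
  by rewrite powR_mulrn// ltW.
apply: le_trans; apply: ger_powR; first by rewrite t0 t1.
rewrite ler_pdivrMr ?ltr0n// mulrAC ler_pdivlMr ?ltr0n ?addn1//.
rewrite -!natrM ler_nat -!mulnA leq_mul2l /= !mulnS [(d * m)%N]mulnC.
by rewrite leq_add2r.
Qed.

(** * Changing and resampling one coordinate *)

Section Update.
Variables (n : nat) (T : finType).
Implicit Types (z : {ffun 'I_n -> T}) (j : 'I_n) (x : T).

Definition upd z j x : {ffun 'I_n -> T} := [ffun i => if i == j then x else z i].

(** Every point arises from a unique value x at j and a unique point whose j-th coordinate is the
    marker x0. Used for multi-indices with marker [ord0], this splits a sum into slices. *)
Lemma sum_upd (x0 : T) j (V : nmodType) (F : {ffun 'I_n -> T} -> V) :
  \sum_z F z = \sum_x \sum_(z : {ffun 'I_n -> T} | z j == x0) F (upd z j x).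
Proof.
rewrite (partition_big (fun z : {ffun 'I_n -> T} => z j) xpredT)//=.
apply: eq_bigr => x _.
rewrite (reindex_onto (fun z => upd z j x) (fun z => upd z j x0)) /=; last first.
  by move=> z /eqP zj; apply/ffunP => i; rewrite !ffunE; case: eqP => // ->.
apply: eq_bigl => z; rewrite !ffunE eqxx eqxx /=.
apply/eqP/eqP => [/ffunP/(_ j)|zj]; first by rewrite !ffunE eqxx.
by apply/ffunP => i; rewrite !ffunE; case: eqP => // ->.
Qed.

(** Each point is reached once from each of the #|T| points that agree with it off j. So a mean over
    the cube may be taken over one fresh coordinate first. *)
Lemma sum_resample j (V : nmodType) (F : {ffun 'I_n -> T} -> V) :
  \sum_z \sum_x F (upd z j x) = (\sum_z F z) *+ #|T|.
Proof.
case: (pickP (@predT T)) => [x0 _|T0]; last first.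
  by rewrite !big1 ?mul0rn// => z; have := T0 (z j).
rewrite (sum_upd x0 j F) (sum_upd x0 j (fun z => \sum_x F (upd z j x))).
rewrite -sumr_const; apply: eq_bigr => y _.
rewrite exchange_big; apply: eq_bigr => x _; apply: eq_bigr => z _.
by congr F; apply/ffunP => i; rewrite !ffunE; case: eqP.
Qed.

End Update.

(** * Polynomials on the cube, Parseval's identity, and the fourth moment in one variable *)

Section Expansion.
Variables (R : realType) (K n : nat).
Local Notation X := (Omega R K.+1).
Local Notation cube := (cube R K.+1 n).
Local Notation mindex := (mindex K.+1 n).
Implicit Types (c : mindex -> R[i]) (z : cube) (a : mindex) (j : 'I_n).

(** The coefficient family is the primary object: slices keep the same index set, so inductions
    never change the dimension n. Writing the order as K.+1 makes the exponent [ord0] available. *)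
Definition ev c z : R[i] := \sum_a c a * monom z a.

Definition supp a : {set 'I_n} := [set j | a j != ord0].

(* ev c z is the sum over k of z_j^k * ev (slice c j k) z, and the factors
   ev (slice c j k) z do not depend on z_j. *)
Definition slice c j (k : 'I_K.+1) a : R[i] :=
  if a j == ord0 then c (upd a j k) else 0.

Lemma card_Omega : #|{: X}| = K.+1.
Proof. by rewrite card_seq_sub ?Omega_seq_uniq// size_map size_iota. Qed.

Lemma card_cube : #|{: cube}| = (K.+1 ^ n)%N.
Proof. by rewrite card_ffun card_Omega card_ord. Qed.

Lemma normc_Omega (x : X) : normc (val x) = 1.
Proof.
apply/eqP; rewrite -(@pexpr_eq1 _ _ K.+1) ?normc_ge0//.
by rewrite -normcX OmegaX1 normc1.
Qed.

Lemma normc_monom z a : normc (monom z a) = 1.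
Proof.
by rewrite normc_prod big1// => j _; rewrite normcX normc_Omega expr1n.
Qed.

Lemma sum_Omega_pow (k : 'I_K.+1) : k != ord0 -> \sum_(x : X) val x ^+ k = 0.
Proof.
move=> k0; have := sum_Omega_expr R k ord0; rewrite (negbTE k0); apply: etrans.
by apply: eq_bigr => x _; rewrite expr0 divr1.
Qed.

Lemma monom_supp z a : monom z a = \prod_(j in supp a) val (z j) ^+ a j.
Proof.
rewrite /monom (bigID (mem (supp a)))/= mulrC big1 ?mul1r// => j.
by rewrite inE negbK => /eqP ->; rewrite expr0.
Qed.

Lemma ev_upd c z j (x : X) :
  ev c (upd z j x) = \sum_(k < K.+1) val x ^+ k * ev (slice c j k) z.
Proof.
rewrite /ev (sum_upd ord0 j); apply: eq_bigr => k _.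
rewrite big_distrr /= [in RHS](bigID (fun a : mindex => a j == ord0)) /=.
rewrite [X in _ = _ + X]big1 ?addr0.
  apply: eq_bigr => a aj; rewrite /slice aj mulrCA; congr (_ * _).
  rewrite /monom (bigD1 j)//= [in RHS](bigD1 j)//= !ffunE eqxx (eqP aj) expr0.
  rewrite mul1r; congr (_ * _); apply: eq_bigr => i ij.
  by rewrite !ffunE (negbTE ij).
by move=> a /negbTE aj; rewrite /slice aj mul0r mulr0.
Qed.

(** Slices are padded with zeros, which contribute nothing since F 0 = 0. *)
Lemma sum_slice (F : R[i] -> R) c j : F 0 = 0 ->
  \sum_a F (c a) = \sum_(k < K.+1) \sum_a F (slice c j k a).
Proof.
move=> F0; rewrite (sum_upd ord0 j); apply: eq_bigr => k _.
rewrite [RHS](bigID (fun a : mindex => a j == ord0)) /= [X in _ + X]big1 ?addr0.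
  by apply: eq_bigr => a aj; rewrite /slice aj.
by move=> a /negbTE aj; rewrite /slice aj.
Qed.

Lemma parseval c : \sum_z normc (ev c z) ^+ 2 =
  K.+1%:R ^+ n * \sum_a normc (c a) ^+ 2.
Proof.
apply: (@complexI R); rewrite rmorphM rmorphXn rmorph_nat !rmorph_sum /=.
(* Monomials have modulus 1, so conjugation is inversion and the orthogonality relation applies. *)
have conj_monom z a : conjc (monom z a) = (monom z a)^-1.
  have nz : monom z a != 0 by apply/prodf_neq0 => i _; rewrite expf_neq0 ?Omega_neq0.
  by apply: (mulfI nz); rewrite conjc_mul_normc normc_monom expr1n divff.
have conj_ev z : conjc (ev c z) = \sum_a conjc (c a) / monom z a.
  by rewrite /ev rmorph_sum; apply: eq_bigr => a _; rewrite rmorphM /= conj_monom.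
transitivity (\sum_z \sum_a \sum_b
    c a * conjc (c b) * (monom z a / monom z b)).
  apply: eq_bigr => z _; rewrite -(conjc_mul_normc (ev c z)).
  rewrite conj_ev /ev mulr_suml.
  apply: eq_bigr => a _; rewrite mulr_sumr; apply: eq_bigr => b _.
  exact: mulrACA.
rewrite exchange_big /= mulr_sumr; apply: eq_bigr => a _.
rewrite exchange_big /= (bigD1 a)//= -mulr_sumr sum_cube_monom eqxx.
rewrite big1 ?addr0 => [|b ba]; first by rewrite conjc_mul_normc mulrC.
by rewrite -mulr_sumr sum_cube_monom eq_sym (negbTE ba) mulr0.
Qed.

(* Expanding |a_0 + h|^4 with h the sum of the terms k <> 0: the term
   4 |a_0|^2 Re (a_0 h^* ) averages to 0 and the remaining odd term is absorbed
   by Cauchy-Schwarz. *)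
Lemma sum_Omega_norm4 (a : 'I_K.+1 -> R[i]) :
  \sum_(x : X) normc (\sum_(k < K.+1) val x ^+ k * a k) ^+ 4 <=
  K.+1%:R * (normc (a ord0) ^+ 4
    + 8 * K.+1%:R * \sum_(k < K.+1 | k != ord0) normc (a ord0) ^+ 2 * normc (a k) ^+ 2
    + 3 * K.+1%:R ^+ 3 * \sum_(k < K.+1 | k != ord0) normc (a k) ^+ 4).
Proof.
pose h (x : X) := \sum_(k < K.+1 | k != ord0) val x ^+ k * a k.
(* This is the real part of a_0 times the conjugate of h(x). *)
pose r (x : X) := Re (a ord0) * Re (h x) + Im (a ord0) * Im (h x).
pose s := \sum_(k < K.+1 | k != ord0) normc (a k) ^+ 2.
have hs x : normc (h x) ^+ 2 <= K.+1%:R * s.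
  have : normc (h x) <= \sum_(k < K.+1 | k != ord0) normc (a k).
    rewrite (le_trans (normc_sum _ _ _))//; apply: ler_sum => k _.
    by rewrite normcM normcX normc_Omega expr1n mul1r.
  move=> /(@lerXn2r _ 2); rewrite !nnegrE normc_ge0 sumr_ge0; last first.
    by move=> k _; exact: normc_ge0.
  move=> /(_ isT isT)/le_trans; apply.
  by have := sqr_sum_le (fun k => k != ord0) (fun k => normc (a k)); rewrite card_ord.
have s0 : 0 <= s by apply: sumr_ge0 => k _; exact: sqr_ge0.
have s2 : s ^+ 2 <= K.+1%:R * \sum_(k < K.+1 | k != ord0) normc (a k) ^+ 4.
  have := sqr_sum_le (fun k => k != ord0) (fun k => normc (a k) ^+ 2).
  by rewrite card_ord; under [in X in _ -> X]eq_bigr do rewrite (exprM _ 2 2).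
have sumr0 : \sum_x r x = 0.
  have sh : \sum_x h x = 0.
    rewrite exchange_big big1// => k k0.
    by rewrite -mulr_suml sum_Omega_pow// mul0r.
  rewrite big_split /= -!mulr_sumr -!raddf_sum sh !raddf0.
  by rewrite !mulr0 addr0.
(* With A = |a_0|^2 and H = |h|^2 the left side is (A + H + 2r)^2. Since 4 H r <= 2 H^2 + 2 r^2 and
   r^2 <= A H, it is at most A^2 + 4 A r + 3 H^2 + 8 A H. *)
have main x : normc (\sum_(k < K.+1) val x ^+ k * a k) ^+ 4 <=
    normc (a ord0) ^+ 4 + 4 * normc (a ord0) ^+ 2 * r x
    + (3 * (K.+1%:R * s) ^+ 2 + 8 * normc (a ord0) ^+ 2 * (K.+1%:R * s)).
  rewrite (bigD1 ord0)//= expr0 mul1r -/(h x).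
  rewrite (exprM _ 2 2) (exprM (normc (a ord0)) 2 2).
  have e : normc (a ord0 + h x) ^+ 2 =
      normc (a ord0) ^+ 2 + normc (h x) ^+ 2 + 2 * r x.
    rewrite !sqr_normcE /r raddfD [Im (_ + _)]raddfD /=; ring.
  have r2 : r x ^+ 2 <= normc (a ord0) ^+ 2 * normc (h x) ^+ 2.
    rewrite !sqr_normcE /r.
    move: (Re _) (Im _) (Re _) (Im _) => p q u v.
    have : 0 <= (p * v - q * u) ^+ 2 by exact: sqr_ge0.
    lra.
  rewrite e; move: (hs x) r2 (sqr_ge0 (normc (a ord0))) (sqr_ge0 (normc (h x))).
  move: (normc (a ord0) ^+ 2) (normc (h x) ^+ 2) (r x) (K.+1%:R * s).
  move=> A H r' U HU r2 A0 H0.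
  have : 0 <= (H - r') ^+ 2 by exact: sqr_ge0.
  have : H ^+ 2 <= U ^+ 2 by rewrite lerXn2r ?nnegrE// (le_trans H0).
  have : A * H <= A * U by rewrite ler_wpM2l.
  lra.
apply: (le_trans (ler_sum _ (fun x _ => main x))).
rewrite [leLHS]big_split /= [X in X + _ <= _]big_split /=.
rewrite -[X in _ + X + _ <= _]mulr_sumr sumr0 mulr0 addr0 !sumr_const.
rewrite card_Omega -mulrnDl -[leLHS]mulr_natl ler_wpM2l// -addrA lerD2l addrC.
apply: lerD; last by rewrite -mulr_sumr -/s le_eqVlt; apply/orP; left; apply/eqP; ring.
move: s2; set S := \sum_(k < K.+1 | _) _ => s2.
have -> : 3 * K.+1%:R ^+ 3 * S = 3 * K.+1%:R ^+ 2 * (K.+1%:R * S) by ring.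
by rewrite exprMn [leLHS]mulrA ler_wpM2l// mulr_ge0// sqr_ge0.
Qed.

End Expansion.

(** * Hypercontractivity by induction on the coordinates *)

Section Hypercontractivity.
Variables (R : realType) (K n : nat).
Local Notation X := (Omega R K.+1).
Local Notation cube := (cube R K.+1 n).
Local Notation mindex := (mindex K.+1 n).
Implicit Types (c : mindex -> R[i]) (z : cube) (a : mindex) (j : 'I_n).

(** Large enough for the induction step: M = [hyper_const] satisfies 8 K.+1 M <= 2 M^2 and 3 K.+1^3
    <= M^2, so the cross and fourth-power terms fit into the square of M (s_0 + T). *)
Definition hyper_const : R := 4 * K.+1%:R ^+ 2.

Lemma supp_upd a j k : a j = ord0 -> supp a = supp (upd a j k) :\ j.
Proof.
move=> aj; apply/finset.setP => i; rewrite !inE ffunE.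
by case: (eqVneq i j) => // ->; rewrite aj eqxx.
Qed.

(** A slice loses the coordinate j, and for k <> 0 this removes an element of the support, lowering
    the bound d by one. *)
Lemma slice_supp (A : {set 'I_n}) d c j k :
  (forall a, c a != 0 -> (supp a \subset A) && (#|supp a| <= d)%N) ->
  forall a, slice c j k a != 0 ->
    (supp a \subset A :\ j) && (#|supp a| <= d - (k != ord0))%N.
Proof.
move=> cA a; rewrite /slice; case: (a j =P ord0) => [aj|]; last by rewrite eqxx.
move=> /cA /andP[sA sd]; rewrite (supp_upd k aj) finset.setSD//=.
have [_|k0] := eqVneq k ord0.
  by rewrite subn0; exact: leq_trans (subset_leq_card (finset.subsetDl _ _)) sd.
have := cardsD1 j (supp (upd a j k)); rewrite inE ffunE ?eqxx k0 add1n => E.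
by rewrite leq_subRL ?(leq_trans _ sd) ?E// add1n -E.
Qed.

(** Resample the coordinate j and apply the one-variable inequality at each z, where the slices act
    as constants. *)
Lemma sum_norm4_le_slices c j :
  \sum_z normc (ev c z) ^+ 4 <=
  \sum_z normc (ev (slice c j ord0) z) ^+ 4
  + 8 * K.+1%:R * (\sum_(k < K.+1 | k != ord0) \sum_z
      normc (ev (slice c j ord0) z) ^+ 2 * normc (ev (slice c j k) z) ^+ 2)
  + 3 * K.+1%:R ^+ 3 * (\sum_(k < K.+1 | k != ord0) \sum_z
      normc (ev (slice c j k) z) ^+ 4).
Proof.
have K0 : 0 < K.+1%:R :> R by rewrite ltr0n.
rewrite -(ler_pM2l K0) [leLHS]mulr_natl -[X in _ *+ X](card_Omega R K).
rewrite -(sum_resample j (fun z => normc (ev c z) ^+ 4)).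
apply: (@le_trans _ _ (\sum_z K.+1%:R * (normc (ev (slice c j ord0) z) ^+ 4
  + 8 * K.+1%:R * (\sum_(k < K.+1 | k != ord0)
      normc (ev (slice c j ord0) z) ^+ 2 * normc (ev (slice c j k) z) ^+ 2)
  + 3 * K.+1%:R ^+ 3 * (\sum_(k < K.+1 | k != ord0)
      normc (ev (slice c j k) z) ^+ 4)))).
  apply: ler_sum => z _; under eq_bigr do rewrite ev_upd.
  exact: sum_Omega_norm4.
rewrite -mulr_sumr ler_wpM2l// !big_split /=.
rewrite -[X in _ + X + _ <= _]mulr_sumr -[X in _ + X <= _]mulr_sumr.
rewrite [X in _ + _ * X + _ <= _]exchange_big /=.
by rewrite [X in _ + _ * X <= _]exchange_big.
Qed.

(** Induction on #|A|, slicing along some j in A. The slice k = 0 keeps d; the others have d - 1,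
    and the factor [hyper_const] so gained pays for the constants of the one-variable inequality. *)
Lemma sum_norm4_le (A : {set 'I_n}) d c :
  (forall a, c a != 0 -> (supp a \subset A) && (#|supp a| <= d)%N) ->
  \sum_z normc (ev c z) ^+ 4 <=
  K.+1%:R ^+ n * (hyper_const ^+ d * \sum_a normc (c a) ^+ 2) ^+ 2.
Proof.
have M0 : 0 <= hyper_const by rewrite mulr_ge0 ?exprn_ge0.
have K1 : 1 <= K.+1%:R :> R by rewrite ler1n.
have M1 : 1 <= hyper_const by rewrite /hyper_const; nra.
have sum0 (b : mindex -> R[i]) : 0 <= \sum_a normc (b a) ^+ 2.
  by apply: sumr_ge0 => a _; exact: sqr_ge0.
have [m] := ubnP #|A|; elim: m => // m IH in A d c *; rewrite ltnS => Am cA.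
(* Either there is a coordinate to slice along and d is positive, or the polynomial is constant. *)
have [[j jA d0]|] : (exists2 j, j \in A & (0 < d)%N) \/
    (forall a, c a != 0 -> a = [ffun=> ord0]).
- have cst : (forall a, c a != 0 -> supp a = finset.set0) ->
      forall a, c a != 0 -> a = [ffun=> ord0].
    move=> h a /h/finset.setP a0; apply/ffunP => i; rewrite ffunE.
    by have := a0 i; rewrite !inE => /negbT; rewrite negbK => /eqP.
  have [A0|[j jA]] := finset.set_0Vmem A.
    right; apply: cst => a /cA/andP[+ _].
    by rewrite A0 finset.subset0 => /eqP.
  case: (posnP d) => [d0|]; last by left; exists j.
  right; apply: cst => a /cA/andP[_].
  by rewrite d0 leqn0 finset.cards_eq0 => /eqP.
- pose b k := slice c j k.
  have bA k : forall a, b k a != 0 ->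
      (supp a \subset A :\ j) && (#|supp a| <= d - (k != ord0))%N.
    exact: slice_supp.
  have ltA : (#|A :\ j| < m)%N by rewrite (leq_trans _ Am)// (cardsD1 j A) jA.
  have {}IH k := IH _ _ _ ltA (bA k).
  set Z : R := K.+1%:R ^+ n in IH *.
  have Z0 : 0 <= Z by rewrite exprn_ge0.
  pose s k := \sum_a normc (b k a) ^+ 2.
  pose mu := hyper_const ^+ d.-1.
  have mu0 : 0 <= mu by rewrite exprn_ge0.
  have muE : hyper_const ^+ d = hyper_const * mu by rewrite -exprS prednK.
  have IH0 : \sum_z normc (ev (b ord0) z) ^+ 4 <= Z * (hyper_const * mu * s ord0) ^+ 2.
    by have := IH ord0; rewrite eqxx subn0 muE.
  have IH1 k : k != ord0 -> \sum_z normc (ev (b k) z) ^+ 4 <= Z * (mu * s k) ^+ 2.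
    by move=> k0; have := IH k; rewrite k0 subn1.
  pose T := \sum_(k < K.+1 | k != ord0) s k.
  have s0 k : 0 <= s k by exact: sum0.
  have T0 : 0 <= T by exact: sumr_ge0.
  have sE : \sum_a normc (c a) ^+ 2 = s ord0 + T.
    rewrite (sum_slice (F := fun x => normc x ^+ 2) c j) ?normc0 ?expr0n//.
    by rewrite (bigD1 ord0).
  (* Cauchy-Schwarz over z separates the two slices into fourth moments, to which the induction
     hypothesis applies. *)
  have cross : \sum_(k < K.+1 | k != ord0) \sum_z
      normc (ev (b ord0) z) ^+ 2 * normc (ev (b k) z) ^+ 2
      <= Z * (hyper_const * mu * s ord0) * (mu * T).
    rewrite [X in _ <= _ * X]mulr_sumr [leRHS]mulr_sumr; apply: ler_sum => k k0.
    have rhs0 : 0 <= Z * (hyper_const * mu * s ord0) * (mu * s k).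
      by rewrite !mulr_ge0.
    rewrite -(@ler_pXn2r _ 2) ?nnegrE//; last first.
      by apply: sumr_ge0 => z _; rewrite mulr_ge0 ?sqr_ge0.
    apply: (le_trans (sum_cauchy_schwarz _ _ _)).
    rewrite (_ : (_ * _ * (mu * s k)) ^+ 2 =
      (Z * (hyper_const * mu * s ord0) ^+ 2) * (Z * (mu * s k) ^+ 2)); last by ring.
    apply: ler_pM.
    + by apply: sumr_ge0 => z _; exact: sqr_ge0.
    + by apply: sumr_ge0 => z _; exact: sqr_ge0.
    + by under eq_bigr do rewrite -exprM.
    + by under eq_bigr do rewrite -exprM; exact: IH1.
  have diag : \sum_(k < K.+1 | k != ord0) \sum_z normc (ev (b k) z) ^+ 4
      <= Z * (mu * T) ^+ 2.
    apply: (le_trans (ler_sum _ IH1)); rewrite -mulr_sumr ler_wpM2l// exprMn.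
    under eq_bigr do rewrite exprMn.
    by rewrite -mulr_sumr ler_wpM2l ?sqr_ge0// sum_sqr_le.
  apply: (le_trans (sum_norm4_le_slices c j)); rewrite -/b sE muE.
  apply: (@le_trans _ _ (Z * mu ^+ 2 * ((hyper_const * s ord0) ^+ 2
    + 8 * K.+1%:R * hyper_const * (s ord0 * T) + 3 * K.+1%:R ^+ 3 * T ^+ 2))).
    rewrite [leRHS](_ : _ = Z * (hyper_const * mu * s ord0) ^+ 2
      + 8 * K.+1%:R * (Z * (hyper_const * mu * s ord0) * (mu * T))
      + 3 * K.+1%:R ^+ 3 * (Z * (mu * T) ^+ 2)); last by ring.
    by rewrite !lerD// ler_wpM2l// mulr_ge0// exprn_ge0.
  rewrite (_ : (_ * _ * (s ord0 + T)) ^+ 2 =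
    mu ^+ 2 * (hyper_const * (s ord0 + T)) ^+ 2); last by ring.
  rewrite -mulrA !ler_wpM2l ?sqr_ge0//.
  have sT : 0 <= s ord0 * T by rewrite mulr_ge0.
  have MK : 8 * K.+1%:R * hyper_const <= 2 * hyper_const ^+ 2.
    rewrite expr2 mulrA ler_wpM2r// /hyper_const; nra.
  have K3 : 3 * K.+1%:R ^+ 3 <= hyper_const ^+ 2.
    rewrite /hyper_const exprMn -exprM (exprS _ 3) mulrA ler_wpM2r ?exprn_ge0//.
    nra.
  rewrite [leRHS](_ : _ = (hyper_const * s ord0) ^+ 2
    + 2 * hyper_const ^+ 2 * (s ord0 * T) + hyper_const ^+ 2 * T ^+ 2); last by ring.
  by rewrite !lerD// ler_wpM2r ?sqr_ge0.
move=> c0; set a0 : mindex := [ffun=> ord0].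
have c0' a : a != a0 -> c a = 0 by move=> aa0; apply: contra_neq_eq aa0 => /c0.
have -> : \sum_a normc (c a) ^+ 2 = normc (c a0) ^+ 2.
  by rewrite (bigD1 a0)//= big1 ?addr0// => a /c0' ->; rewrite normc0 expr0n.
have evE z : normc (ev c z) = normc (c a0).
  rewrite /ev (bigD1 a0)//= big1 ?addr0 => [|a /c0' ->]; last by rewrite mul0r.
  by rewrite normcM normc_monom mulr1.
under eq_bigr do rewrite evE.
rewrite sumr_const card_cube -[leLHS]mulr_natl natrX ler_wpM2l ?exprn_ge0//.
rewrite [leRHS]exprMn -[X in _ <= _ * X]exprM ler_peMl ?exprn_ge0 ?normc_ge0//.
by rewrite -exprM exprn_ege1.
Qed.

(* Optimising x^2 <= s x + x^4 / s^2 over s turns the comparison of the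
   fourth and second moments into one of the second and first moments. *)
Lemma l2_le_l1 d c : (forall a, c a != 0 -> (#|supp a| <= d)%N) ->
  K.+1%:R ^+ n * Num.sqrt (\sum_a normc (c a) ^+ 2) <=
  4 * hyper_const ^+ d * \sum_z normc (ev c z).
Proof.
move=> cd; set mu := hyper_const ^+ d; set Z := K.+1%:R ^+ n.
set v := \sum_a normc (c a) ^+ 2; set E := \sum_z normc (ev c z).
have K0 : 0 < K.+1%:R :> R by rewrite ltr0n.
have Z0 : 0 < Z by rewrite exprn_gt0.
have mu0 : 0 < mu by rewrite exprn_gt0// mulr_gt0// exprn_gt0.
have E0 : 0 <= E by apply: sumr_ge0 => z _; exact: normc_ge0.
have v0 : 0 <= v by apply: sumr_ge0 => a _; exact: sqr_ge0.
have [->|vn0] := eqVneq v 0.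
  by rewrite sqrtr0 mulr0 !mulr_ge0// ltW.
have v1 : 0 < v by rewrite lt_def vn0.
set w := Num.sqrt v; have w0 : 0 < w by rewrite sqrtr_gt0.
have vE : v = w ^+ 2 by rewrite sqr_sqrtr.
(* With this s the fourth-moment term is a quarter of Z v and is absorbed on the left. *)
pose s := 2 * mu * w; have s0 : 0 < s by rewrite !mulr_gt0.
have pt (x : R) : 0 <= x -> x ^+ 2 <= s * x + x ^+ 4 / s ^+ 2.
  move=> x0; have [xs|/ltW sx] := leP x s.
    apply: ler_wpDr; first by rewrite divr_ge0 ?exprn_ge0// ltW.
    by rewrite expr2 ler_wpM2r.
  apply: ler_wpDl; first by rewrite mulr_ge0// ltW.
  rewrite ler_pdivlMr ?exprn_gt0// (exprD x 2 2) ler_wpM2l ?sqr_ge0//.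
  by rewrite lerXn2r ?nnegrE// ltW.
have h4 : \sum_z normc (ev c z) ^+ 4 <= Z * (mu * v) ^+ 2.
  by apply: (@sum_norm4_le [set: 'I_n]) => a /cd ->; rewrite finset.subsetT.
have h : Z * v <= s * E + Z * (mu * v) ^+ 2 / s ^+ 2.
  rewrite -parseval (le_trans (ler_sum _ (fun z _ => pt _ (normc_ge0 (ev c z)))))//.
  rewrite big_split /= -mulr_sumr -mulr_suml lerD2l ler_wpM2r// invr_ge0.
  exact: sqr_ge0.
have e : Z * (mu * v) ^+ 2 / s ^+ 2 = Z * w ^+ 2 / 4.
  by rewrite vE /s; field; rewrite !gt_eqF.
rewrite e vE in h; rewrite -(ler_pM2r w0).
have : 0 <= mu * w * E by rewrite !mulr_ge0// ltW.
have : 0 <= Z * w ^+ 2 by rewrite mulr_ge0 ?sqr_ge0// ltW.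
by rewrite /s in h; lra.
Qed.

End Hypercontractivity.

(** * Extension to product measures and its bound near the uniform measure *)

Section ProductMeasures.
Variables (R : realType) (K n : nat).
Local Notation X := (Omega R K.+1).
Local Notation cube := (cube R K.+1 n).
Local Notation mindex := (mindex K.+1 n).
Implicit Types (c : mindex -> R[i]) (z : cube) (a : mindex) (j : 'I_n).

Definition moment (w : 'I_n -> X -> R[i]) j (k : nat) : R[i] :=
  \sum_x w j x * val x ^+ k.

(* When every w j has total mass 0, this is the value of the multi-affine
   extension of ev c at the product of the measures (uniform + w j). *)
Definition ev_moment c (w : 'I_n -> X -> R[i]) : R[i] :=
  \sum_a c a * \prod_(j in supp a) moment w j (a j).

(** The derivative of [ev_moment c], at the point masses of the z_j, in the direction w. The powers
    z_j^k with k <> 0 act as independent variables. *)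
Definition linear_part c z (w : 'I_n -> X -> R[i]) : R[i] :=
  \sum_j \sum_(k < K.+1 | k != ord0) moment w j k * ev (slice c j k) z.

(** The sum is the expectation of [ev c] at a point with independent coordinates of laws [rho j],
    hence a convex combination of its values. *)
Lemma ev_mean_le c (N : R) (rho : 'I_n -> X -> R) :
  (forall j x, 0 <= rho j x) -> (forall j, \sum_x rho j x = 1) ->
  (forall z, normc (ev c z) <= N) ->
  normc (\sum_a c a * \prod_j moment (fun j x => (rho j x)%:C) j (a j)) <= N.
Proof.
move=> rho0 rho1 cN.
have -> : \sum_a c a * \prod_j moment (fun j x => (rho j x)%:C) j (a j) =
    \sum_(z : cube) (\prod_j rho j (z j))%:C * ev c z.
  under [RHS]eq_bigr do rewrite mulr_sumr.
  rewrite exchange_big /=; apply: eq_bigr => a _.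
  rewrite bigA_distr_bigA mulr_sumr; apply: eq_bigr => z _.
  by rewrite mulrCA rmorph_prod -big_split.
rewrite (le_trans (normc_sum _ _ _))//.
have <- : \sum_(z : cube) (\prod_j rho j (z j)) * N = N.
  rewrite -mulr_suml -(bigA_distr_bigA rho) (eq_bigr _ (fun j _ => rho1 j)).
  by rewrite big1_eq mul1r.
apply: ler_sum => z _; rewrite normcM normc_real ger0_norm ?prodr_ge0//.
by rewrite ler_wpM2l// prodr_ge0.
Qed.

(** Subtracting from [w j] its mean and adding the uniform measure changes no moment of order k <>
    0, and the smallness of w makes the result a probability measure. *)
Lemma ev_moment_small_le c (N : R) (w : 'I_n -> X -> R) :
  (forall j x, `|w j x| <= (2 * K.+1%:R)^-1) ->
  (forall z, normc (ev c z) <= N) ->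
  normc (ev_moment c (fun j x => (w j x)%:C)) <= N.
Proof.
move=> wK cN; have K0 : 0 < K.+1%:R :> R by rewrite ltr0n.
pose m j := (\sum_x w j x) / K.+1%:R.
have mK j : `|m j| <= (2 * K.+1%:R)^-1.
  rewrite normrM normfV normr_nat ler_pdivrMr//.
  rewrite (le_trans (ler_norm_sum _ _ _))// (le_trans (ler_sum _ (fun x _ => wK j x)))//.
  by rewrite sumr_const card_Omega [leRHS]mulr_natr.
pose rho j x := K.+1%:R^-1 + w j x - m j.
have rho0 j x : 0 <= rho j x.
  have := wK j x; have := mK j; rewrite !ler_norml invfM => /andP[h1 h2] /andP[h3 h4].
  rewrite /rho; move: h1 h2 h3 h4; move: (m j) (w j x) (K.+1%:R^-1).
  move=> p q r; lra.
have rho1 j : \sum_x rho j x = 1.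
  rewrite sumrB big_split /= !sumr_const card_Omega -[_^-1 *+ _]mulr_natr.
  rewrite -[m j *+ _]mulr_natr mulVf ?gt_eqF//.
  by rewrite /m divfK ?gt_eqF// addrK.
rewrite (le_trans _ (ev_mean_le rho0 rho1 cN))// le_eqVlt; apply/orP; left.
apply/eqP; congr normc; apply: eq_bigr => a _; congr (_ * _).
rewrite [RHS](bigID (mem (supp a))) /= [X in _ = _ * X]big1 ?mulr1.
  apply: eq_bigr => j; rewrite inE => aj; rewrite /moment.
  under [RHS]eq_bigr do rewrite rmorphB rmorphD mulrBl mulrDl.
  rewrite sumrB big_split /= -!mulr_sumr sum_Omega_pow// !mulr0.
  by rewrite add0r subr0.
move=> j; rewrite inE negbK => /eqP ->; rewrite /moment.
under eq_bigr do rewrite expr0 mulr1.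
by rewrite -rmorph_sum rho1.
Qed.

Lemma linear_part_Re_Im c z w : linear_part c z w =
  linear_part c z (fun j x => (Re (w j x))%:C) +
  'i%C * linear_part c z (fun j x => (Im (w j x))%:C).
Proof.
rewrite /linear_part mulr_sumr -big_split; apply: eq_bigr => j _.
rewrite mulr_sumr -big_split; apply: eq_bigr => k _ /=.
rewrite mulrA -mulrDl /moment; congr (_ * _).
rewrite mulr_sumr -big_split; apply: eq_bigr => x _ /=.
by rewrite mulrA -mulrDl -complexE.
Qed.

End ProductMeasures.

(** * Bounds on the extension for large signed measures and on its derivative *)

Lemma coef1_prod (F : comNzRingType) (I : finType) (S : {set I}) (u v : I -> F) :
  (\prod_(i in S) ((u i)%:P + v i *: 'X))`_1 =
  \sum_(i in S) v i * \prod_(j in S | j != i) u j.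
Proof.
pose p i : {poly F} := (u i)%:P + v i *: 'X.
have p0 i : (p i)`_0 = u i by rewrite coefD coefC coefZ coefX mulr0 addr0.
have p1 i : (p i)`_1 = v i by rewrite coefD coefC coefZ coefX mulr1 add0r.
rewrite -big_enum -[RHS]big_enum /=.
under [RHS]eq_bigr do rewrite -big_enum_cond.
elim: (enum S) (enum_uniq S) => [_|i r IH /= /andP[ir ur]].
  by rewrite !big_nil coef1.
rewrite !big_cons coefM big_ord_recl big_ord1 /= -/(p _) p0 p1 IH//.
have c0 : (\prod_(j <- r) p j)`_0 = \prod_(j <- r) u j.
  elim: (r) => [|j s IHs]; first by rewrite !big_nil coef1.
  by rewrite !big_cons coef0M p0 IHs.
rewrite c0 eqxx /= [LHS]addrC; congr (_ * _ + _).
  rewrite [RHS]big_seq_cond [LHS]big_seq; apply: eq_bigl => j.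
  by case: eqVneq => [->|]; rewrite ?andbT// (negbTE ir).
rewrite mulr_sumr big_seq [RHS]big_seq; apply: eq_bigr => j jr.
have ij : i != j by apply: contraNneq ir => ->.
by rewrite big_cons ij mulrCA.
Qed.

(** Along t -> t w the extension is a polynomial in t of degree at most d, bounded by N for small t.
    Its d + 1 coefficients are therefore at most C N, and so is each term of its value at t = 1. *)
Lemma ev_moment_le (R : realType) (K d : nat) (L : R) : 0 < L ->
  exists2 C : R, 0 <= C & forall (n : nat) (c : mindex K.+1 n -> R[i]) (N : R),
    (forall a, c a != 0 -> (#|supp a| <= d)%N) ->
    0 <= N -> (forall z : cube R K.+1 n, normc (ev c z) <= N) ->
    forall w : 'I_n -> Omega R K.+1 -> R, (forall j x, `|w j x| <= L) ->
    normc (ev_moment c (fun j x => (w j x)%:C)) <= C * N.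
Proof.
move=> L0; have e0 : 0 < (2 * K.+1%:R * L)^-1 by rewrite invr_gt0 !mulr_gt0.
have [C C0 HC] := poly_coef_bound d e0.
exists (d.+1%:R * C); first by rewrite mulr_ge0.
move=> n c N cd N0 cN w wL.
pose W j x := (w j x)%:C.
pose p : {poly R[i]} :=
  \sum_a (c a * \prod_(j in supp a) moment W j (a j)) *: 'X^#|supp a|.
have sp : (size p <= d.+1)%N.
  rewrite (leq_trans (size_sum _ _ _))//; apply/bigmax_leqP => a _.
  have [->|ca] := eqVneq (c a) 0; first by rewrite mul0r scale0r size_poly0.
  by rewrite (leq_trans (size_scale_leq _ _))// size_polyXn ltnS cd.
have pE (t : R) : p.[t%:C] = ev_moment c (fun j x => (t * w j x)%:C).
  rewrite horner_sum; apply: eq_bigr => a _.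
  rewrite hornerZ hornerXn -mulrA; congr (_ * _).
  rewrite mulrC -prodr_const -big_split; apply: eq_bigr => j _ /=.
  by rewrite /moment mulr_sumr; apply: eq_bigr => x _; rewrite mulrA -rmorphM.
have pN (t : R) : `|t| <= (2 * K.+1%:R * L)^-1 -> normc p.[t%:C] <= N.
  move=> te; rewrite pE; apply: ev_moment_small_le => // j x.
  rewrite normrM (le_trans (ler_pM _ _ te (wL j x)))//.
  by rewrite invfM divfK ?gt_eqF.
have {}HC := HC p N N0 sp pN.
have -> : ev_moment c W = p.[1%:C].
  by rewrite pE; congr ev_moment; do 2! apply/funext => ?; rewrite mul1r.
rewrite (horner_coef_wide _ sp) (le_trans (normc_sum _ _ _))//.
rewrite -mulrA -[d.+1 in leRHS]card_ord mulr_natl -sumr_const.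
apply: ler_sum => i _; rewrite normcM normcX normc_real normr1 expr1n mulr1.
exact: HC.
Qed.

(** The polynomial q(t) is the extension at the point mass of z plus t w. It is bounded for |t| <=
    1, and its coefficient of t is the linear part. *)
Lemma linear_part_le (R : realType) (K d : nat) :
  exists2 C : R, 0 <= C & forall (n : nat) (c : mindex K.+1 n -> R[i]) (N : R),
    (forall a, c a != 0 -> (#|supp a| <= d)%N) ->
    0 <= N -> (forall z : cube R K.+1 n, normc (ev c z) <= N) ->
    forall z (w : 'I_n -> Omega R K.+1 -> R), (forall j x, `|w j x| <= 1) ->
    normc (linear_part c z (fun j x => (w j x)%:C)) <= C * N.
Proof.
(* The bound 2 covers a point mass plus t w with |t| <= 1 and |w| <= 1. *)
have [C1 C10 HC1] := @ev_moment_le R K d 2 (ltr0n _ _).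
have [C2 C20 HC2] := @poly_coef_bound R d 1 ltr01.
exists (C2 * C1); first by rewrite mulr_ge0.
move=> n c N cd N0 cN z w wL.
pose W j x := (w j x)%:C.
pose q : {poly R[i]} := \sum_a c a *:
  \prod_(j in supp a) ((val (z j) ^+ a j)%:P + moment W j (a j) *: 'X).
have sq : (size q <= d.+1)%N.
  rewrite (leq_trans (size_sum _ _ _))//; apply/bigmax_leqP => a _.
  have [->|ca] := eqVneq (c a) 0; first by rewrite scale0r size_poly0.
  rewrite (leq_trans (size_scale_leq _ _))//.
  rewrite (leq_trans (size_poly_prod_leq _ _))// leq_subLR.
  apply: (@leq_trans (#|supp a| * 2).+1).
    rewrite ltnS -sum_nat_const; apply: leq_sum => j _.
    rewrite (leq_trans (size_polyD _ _))// geq_max.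
    rewrite (leq_trans (size_polyC_leq1 _))//=.
    by rewrite (leq_trans (size_scale_leq _ _))// size_polyX.
  by rewrite muln2 -addnn -addnS leq_add2l ltnS cd.
have qN (t : R) : `|t| <= 1 -> normc q.[t%:C] <= C1 * N.
  move=> t1; pose D j x : R := (x == z j)%:R + t * w j x.
  have -> : q.[t%:C] = ev_moment c (fun j x => (D j x)%:C).
    rewrite horner_sum; apply: eq_bigr => a _.
    rewrite hornerZ horner_prod; congr (_ * _); apply: eq_bigr => j _.
    rewrite !hornerE /moment /D.
    under [RHS]eq_bigr do rewrite rmorphD mulrDl.
    rewrite big_split /= [X in _ = X + _](bigD1 (z j))//= eqxx mul1r.
    rewrite [X in _ = _ + X + _]big1 ?addr0.
      congr (_ + _); rewrite mulr_suml; apply: eq_bigr => x _.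
      by rewrite rmorphM /= mulrC mulrA.
    by move=> x /negbTE ->; rewrite mul0r.
  apply: HC1 => // j x; rewrite /D (le_trans (ler_normD _ _))//.
  rewrite (_ : 2 = 1 + 1)// lerD//; first by rewrite normr_nat lern1 leq_b1.
  by rewrite normrM -[leRHS]mulr1 ler_pM.
have {HC2} := HC2 q (C1 * N) (mulr_ge0 C10 N0) sq qN 1%N.
rewrite mulrA; apply: le_trans; rewrite le_eqVlt; apply/orP; left; apply/eqP.
(* The product rule gives a sum over a and j in the support of a. Grouping by k = a j and resetting
   a j to 0 leaves the terms of [slice c j k]. *)
congr normc; apply: esym; rewrite coef_sum /linear_part.
under [LHS]eq_bigr do rewrite coefZ coef1_prod mulr_sumr.
rewrite [LHS](exchange_big_dep xpredT) //=; apply: eq_bigr => j _.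
rewrite big_mkcond /= (sum_upd ord0 j) [LHS](bigID (fun k : 'I_K.+1 => k != ord0)) /=.
rewrite [X in _ + X = _]big1 ?addr0 => [|k]; last first.
  by rewrite negbK => /eqP ->; rewrite big1// => a _; rewrite inE ffunE eqxx eqxx.
apply: eq_bigr => k k0; rewrite /ev mulr_sumr.
rewrite [RHS](bigID (fun a : mindex K.+1 n => a j == ord0)) /=.
rewrite [X in _ = _ + X]big1 ?addr0.
  apply: eq_bigr => a aj; rewrite inE !ffunE eqxx k0 /slice aj.
  rewrite [LHS]mulrCA; congr (_ * (_ * _)).
  rewrite monom_supp (supp_upd k (eqP aj)); apply: eq_big => i.
    by rewrite !inE andbC.
  by rewrite ffunE => /andP[_ /negbTE ->].
by move=> a /negbTE aj; rewrite /slice aj mul0r mulr0.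
Qed.

(** Duality: [linear_part] is tested on directions that select the exponent k and align the phases
    of the slices. Their real and imaginary parts are bounded separately, whence the factor 2. *)
Lemma sum_normc_slice_le (R : realType) (K d : nat) :
  exists2 C : R, 0 <= C & forall (n : nat) (c : mindex K.+1 n -> R[i]) (N : R),
    (forall a, c a != 0 -> (#|supp a| <= d)%N) ->
    0 <= N -> (forall z : cube R K.+1 n, normc (ev c z) <= N) ->
    forall (z : cube R K.+1 n) (k : 'I_K.+1), k != ord0 ->
    \sum_j normc (ev (slice c j k) z) <= C * N.
Proof.
have [C C0 HC] := linear_part_le R K d.
exists (2 * C); first by rewrite mulr_ge0.
move=> n c N cd N0 cN z k k0.
have /choice[u uP] : forall j, exists u : R[i], normc u <= 1 /\
    u * ev (slice c j k) z = (normc (ev (slice c j k) z))%:C.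
  by move=> j; have [u] := normc_phase (ev (slice c j k) z); exists u.
(* By orthogonality of characters the moment of order k is [u j] and those of the other orders below
   K.+1 vanish. *)
pose w j (x : Omega R K.+1) := u j / K.+1%:R / val x ^+ k.
have w1 j x : normc (w j x) <= 1.
  rewrite normcM normcV normcX normc_Omega expr1n invr1 mulr1 normcM normcV.
  rewrite -(rmorph_nat (real_complex R)) normc_real normr_nat.
  by rewrite ler_pdivrMr// mul1r (le_trans (proj1 (uP j)))// ler1n.
have wE : linear_part c z w = (\sum_j normc (ev (slice c j k) z))%:C.
  rewrite rmorph_sum; apply: eq_bigr => j _ /=.
  have mE k' : moment w j (k' : 'I_K.+1) = if k' == k then u j else 0.
    transitivity (u j / K.+1%:R * \sum_(x : Omega R K.+1) val x ^+ k' / val x ^+ k).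
      by rewrite mulr_sumr; apply: eq_bigr => x _; rewrite mulrA mulrAC.
    rewrite sum_Omega_expr; case: ifP => _; last by rewrite mulr0.
    by rewrite divfK// pnatr_eq0.
  rewrite (bigD1 k)//= mE eqxx (proj2 (uP j)) big1 ?addr0// => k' /andP[_].
  by move=> /negbTE h; rewrite mE h mul0r.
have := normc_ge0 (linear_part c z w).
rewrite [X in normc X]wE normc_real => _.
have <- : normc (linear_part c z w) = \sum_j normc (ev (slice c j k) z).
  by rewrite wE normc_real ger0_norm// sumr_ge0// => j _; exact: normc_ge0.
rewrite linear_part_Re_Im (le_trans (le_normcD _ _))// -mulrA mulr_natl mulr2n.
rewrite lerD ?HC// => [j x|]; first by rewrite (le_trans (normc_Re_le _)).
rewrite normcM (_ : normc 'i%C = 1) ?mul1r; last first.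
  by rewrite /normc /= expr0n expr1n add0r sqrtr1.
by apply: HC => // j x; rewrite (le_trans (normc_Im_le _)).
Qed.

(** * Mixed norms and the summation of Blei's inequality *)

Section MixedNorms.
Variables (K n : nat).
Local Notation mindex := (mindex K.+1 n).

Definition mixed_norm (R : realType) (t : mindex -> R) (j : 'I_n) (k : 'I_K.+1) : R :=
  Num.sqrt (\sum_(a : mindex | a j == k) t a ^+ 2).

Lemma mixed_norm_slice (R : realType) (c : mindex -> R[i]) j k :
  mixed_norm (fun a => normc (c a)) j k =
  Num.sqrt (\sum_a normc (slice c j k a) ^+ 2).
Proof.
congr Num.sqrt; rewrite big_mkcond /= (sum_upd ord0 j) (bigD1 k)//=.
rewrite [X in _ + X]big1 ?addr0.
  rewrite [RHS](bigID (fun a : mindex => a j == ord0)) /=.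
  rewrite [X in _ = _ + X]big1 ?addr0.
        by apply: eq_bigr => a aj; rewrite ffunE eqxx eqxx /slice aj.
  by move=> a /negbTE aj; rewrite /slice aj normc0 expr0n.
by move=> k' k'k; rewrite big1// => a _; rewrite ffunE eqxx (negbTE k'k).
Qed.

(** In the bound, 1 comes from the quotients t_a^2 / g and [expR 1] from the products of the g,
    among them the empty product, which accounts for the zero index. *)
Lemma sum_powR_le (R : realType) (d : nat) (t : mindex -> R) : (0 < d)%N ->
  (forall a, 0 <= t a) -> (forall a, t a != 0 -> (#|supp a| <= d)%N) ->
  t [ffun=> ord0] <= 1 ->
  \sum_j \sum_(k < K.+1 | k != ord0) mixed_norm t j k <= 1 ->
  \sum_a t a `^ ((2 * d)%:R / (d + 1)%:R) <= 1 + expR 1.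
Proof.
move=> d0 t0 td t1 G1; set g := mixed_norm t in G1.
have p0 : (2 * d)%:R / (d + 1)%:R != 0 :> R.
  by rewrite mulf_neq0 ?invr_eq0 ?pnatr_eq0 ?muln_eq0 ?addn1 -?lt0n.
have g0 j k : 0 <= g j k by exact: sqrtr_ge0.
have tg a j : t a <= g j (a j).
  rewrite -ler_sqr ?nnegrE ?g0// sqr_sqrtr; last first.
    by apply: sumr_ge0 => b _; exact: sqr_ge0.
  by rewrite (bigD1 a)//= lerDl; apply: sumr_ge0 => b _; exact: sqr_ge0.
have g1 j k : k != ord0 -> g j k <= 1.
  move=> k0; rewrite (le_trans _ G1)// (bigD1 j)//= (bigD1 k)//= -addrA lerDl.
  rewrite addr_ge0//; first by exact: sumr_ge0.
  by apply: sumr_ge0 => i _; exact: sumr_ge0.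
have pt a : t a `^ ((2 * d)%:R / (d + 1)%:R) <=
    \sum_(j in supp a) t a ^+ 2 / g j (a j) + \prod_(j in supp a) g j (a j).
  have [ta|tan0] := eqVneq (t a) 0.
    rewrite ta powR0// addr_ge0 ?sumr_ge0 ?prodr_ge0// => j _.
    by rewrite expr0n mul0r.
  have [sa|[j ja]] := finset.set_0Vmem (supp a).
    rewrite sa !big_set0 add0r.
    have -> : a = [ffun=> ord0].
      apply/ffunP => j; rewrite ffunE; move/finset.setP: sa => /(_ j).
      by rewrite !inE => /negbFE/eqP.
    apply: (@le_trans _ _ (1 `^ ((2 * d)%:R / (d + 1)%:R))); last by rewrite powR1.
    by rewrite ge0_ler_powR ?nnegrE.
  apply: powR_le_blei => //.
  - by rewrite t0 (le_trans (tg a j))// g1//; move: ja; rewrite inE.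
  - by rewrite card_gt0; apply/set0Pn; exists j.
  - exact: td.
apply: (le_trans (ler_sum _ (fun a _ => pt a))); rewrite big_split /= lerD//.
  rewrite (le_trans _ G1)// (exchange_big_dep xpredT)//=; apply: ler_sum => j _.
  rewrite (partition_big (fun a : mindex => a j) (fun k => k != ord0)) /=; last first.
    by move=> a; rewrite inE.
  apply: ler_sum => k k0.
  have -> : \sum_(a : mindex | (j \in supp a) && (a j == k)) t a ^+ 2 / g j (a j) =
      g j k ^+ 2 / g j k.
    rewrite sqr_sqrtr; last by apply: sumr_ge0 => b _; exact: sqr_ge0.
    rewrite mulr_suml; apply: eq_big => a; last by move=> /andP[_ /eqP ->].
    by rewrite inE; case: (a j =P k) => [->|_]; rewrite ?k0 ?andbF.
  (* If [g j k] is 0, division by zero yields 0, which is again [g j k]. *)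
  have [->|gn0] := eqVneq (g j k) 0; first by rewrite expr0n mul0r.
  by rewrite expr2 mulfK.
(* The weight 1 at [ord0] extends the products over supports to all coordinates, so that the sum
   over a factors. *)
pose h j k := if k == ord0 then 1 else g j k.
have -> : \sum_(a : mindex) \prod_(j in supp a) g j (a j) =
    \prod_j \sum_(k < K.+1) h j k.
  rewrite bigA_distr_bigA; apply: eq_bigr => a _.
  rewrite [RHS](bigID (mem (supp a))) /= [X in _ = _ * X]big1 ?mulr1.
    by apply: eq_bigr => j; rewrite inE /h => /negbTE ->.
  by move=> j; rewrite inE negbK /h => ->.
have hE j : \sum_(k < K.+1) h j k = 1 + \sum_(k < K.+1 | k != ord0) g j k.
  rewrite (bigD1 ord0)//= /h eqxx; congr (_ + _).
  by apply: eq_bigr => k /negbTE ->.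
under eq_bigr do rewrite hE.
rewrite (le_trans (prod_add1_le_expR _))// ?ler_expR// => j _.
exact: sumr_ge0.
Qed.

End MixedNorms.

(** * The total mixed norm bounded by the supremum norm *)

(** Hypercontractivity bounds each mixed norm by the mean modulus of a slice; the sum over j is then
    taken inside the mean and bounded at each z. *)
Lemma sum_mixed_norm_le (R : realType) (K d : nat) :
  exists2 C : R, 0 <= C & forall (n : nat) (c : mindex K.+1 n -> R[i]) (N : R),
    (forall a, c a != 0 -> (#|supp a| <= d)%N) ->
    0 <= N -> (forall z : cube R K.+1 n, normc (ev c z) <= N) ->
    \sum_j \sum_(k < K.+1 | k != ord0) mixed_norm (fun a => normc (c a)) j k
      <= C * N.
Proof.
have [C C0 HC] := sum_normc_slice_le R K d.
pose mu : R := 4 * hyper_const R K ^+ d.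
have mu0 : 0 <= mu by rewrite mulr_ge0// exprn_ge0// mulr_ge0// exprn_ge0.
(* K.+1 bounds the number of exponents k, mu is the hypercontractive constant, and C bounds the sum
   over j of the slices. *)
exists (K.+1%:R * (mu * C)); first by rewrite mulr_ge0// mulr_ge0.
move=> n c N cd N0 cN; rewrite exchange_big /=.
apply: (@le_trans _ _ (\sum_(k < K.+1) mu * C * N)); last first.
  by rewrite sumr_const card_ord -[leLHS]mulr_natl !mulrA.
rewrite [leRHS](bigID (fun k => k != ord0)) /= ler_wpDr//.
  by apply: sumr_ge0 => k _; rewrite mulr_ge0// mulr_ge0.
apply: ler_sum => k k0.
set Z : R := K.+1%:R ^+ n; have Z0 : 0 < Z by rewrite exprn_gt0.
rewrite -(ler_pM2l Z0) mulr_sumr.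
apply: (@le_trans _ _ (mu * \sum_z \sum_j normc (ev (slice c j k) z))).
  rewrite exchange_big /= mulr_sumr; apply: ler_sum => j _.
  rewrite mixed_norm_slice l2_le_l1// => a.
  have cT b : c b != 0 -> (supp b \subset [set: 'I_n]) && (#|supp b| <= d)%N.
    by move=> /cd ->; rewrite finset.subsetT.
  by move=> /(slice_supp cT)/andP[_ /leq_trans]; apply; exact: leq_subr.
rewrite -mulrA mulrCA ler_wpM2l//.
apply: (@le_trans _ _ (\sum_(z : cube R K.+1 n) C * N)).
  by apply: ler_sum => z _; exact: HC.
by rewrite sumr_const card_cube -[leLHS]mulr_natl natrX.
Qed.

(** * From mixed norms to the norm of the coefficients *)

(** By Parseval |c_a|^2 is at most the mean of |ev c|^2. This controls the coefficient of the zero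
    index, which no mixed norm with k <> 0 sees. *)
Lemma normc_coef_le (R : realType) (K n : nat) (c : mindex K.+1 n -> R[i]) (N : R) a :
  0 <= N -> (forall z : cube R K.+1 n, normc (ev c z) <= N) -> normc (c a) <= N.
Proof.
move=> N0 cN; rewrite -ler_sqr ?nnegrE ?normc_ge0//.
have Z0 : 0 < K.+1%:R ^+ n :> R by rewrite exprn_gt0.
apply: (@le_trans _ _ (\sum_b normc (c b) ^+ 2)).
  by rewrite (bigD1 a)//= lerDl; apply: sumr_ge0 => b _; exact: sqr_ge0.
rewrite -(ler_pM2l Z0) -parseval -natrX -(card_cube R) mulr_natl -sumr_const.
by apply: ler_sum => z _; rewrite lerXn2r ?nnegrE ?normc_ge0.
Qed.

(** Turns the bound on the degree into the bound on supports used above. *)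
Lemma card_supp_le_mabs (K n : nat) (a : mindex K.+1 n) : (#|supp a| <= mabs a)%N.
Proof.
rewrite -sum1_card /mabs big_mkcond; apply: leq_sum => j _.
by rewrite inE; case: eqVneq => // aj; rewrite lt0n.
Qed.

Theorem corollary3 (R : realType) (d K : nat) (hd : (1 <= d)%N) (hK : (2 <= K)%N) :
  exists C : R, 0 < C /\
    forall n : nat, (1 <= n)%N ->
    forall f : cube R K n -> R[i], (fdeg f <= d)%N ->
      lpnorm ((2 * d)%:R / (d + 1)%:R) (fourier f) <= C * supnorm f.
Proof.
case: K hK => // K _; have [C C0 HC] := sum_mixed_norm_le R K d.
set p : R := (2 * d)%:R / (d + 1)%:R.
have p0 : 0 < p by rewrite divr_gt0 ?ltr0n ?addn1// muln_gt0.
pose A : R := (1 + expR 1) `^ p^-1.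
have A0 : 0 < A by rewrite powR_gt0// addr_gt0 ?expR_gt0.
(* In 1 + C, the 1 serves the zero coefficient and C the mixed norms. *)
exists (A * (1 + C)); split; first by rewrite mulr_gt0// ltr_wpDr.
move=> n _ f fd; set c := fourier f; set N := supnorm f.
have fE z : f z = ev c z by exact: fourierP.
have [fN [z0 NE]] := supnorm_max f (ltn0Sn K).
have N0 : 0 <= N by rewrite /N NE normc_ge0.
have cN z : normc (ev c z) <= N by rewrite -fE.
have cd a : c a != 0 -> (#|supp a| <= d)%N.
  move=> ca; apply: leq_trans (card_supp_le_mabs a) _.
  by move: fd; rewrite fdeg_le leqNgt => /(_ a) h; apply: contraNN ca => /h/eqP.
(* The coefficients are scaled by a positive B above (1 + C) N, which may itself be 0 when f = 0.
   The slack e / A then costs exactly e. *)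
suff main B : 0 < B -> (1 + C) * N <= B -> lpnorm p c <= A * B.
  apply/ler_addgt0Pr => e e0.
  have /main : 0 < (1 + C) * N + e / A.
    by rewrite ltr_wpDl ?divr_gt0// mulr_ge0// addr_ge0.
  rewrite lerDl divr_ge0 ?(ltW e0) ?(ltW A0)// => /(_ isT)/le_trans; apply.
  by rewrite mulrDr mulrA [A * (e / A)]mulrC divfK// gt_eqF.
move=> B0 NB; pose t a := normc (c a) / B.
have tE : \sum_a t a `^ p <= 1 + expR 1.
  apply: sum_powR_le => //.
  - by move=> a; rewrite divr_ge0 ?normc_ge0// ltW.
  - move=> a ta; apply: cd; apply: contraNneq ta => ca.
    by rewrite /t ca normc0 mul0r.
  - rewrite ler_pdivrMr// mul1r (le_trans (normc_coef_le _ N0 cN))//.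
    by rewrite (le_trans _ NB)// ler_peMl// lerDl.
  - have mE j k : mixed_norm t j k = mixed_norm (fun a => normc (c a)) j k / B.
      rewrite /mixed_norm; under eq_bigr do rewrite exprMn.
      rewrite -mulr_suml sqrtrM ?sumr_ge0// => [|a _]; last exact: sqr_ge0.
      by rewrite sqrtr_sqr ger0_norm// invr_ge0 ltW.
    under eq_bigr => j _ do (under eq_bigr do rewrite mE; rewrite -mulr_suml).
    rewrite -mulr_suml ler_pdivrMr// mul1r (le_trans (HC _ _ _ cd N0 cN))//.
    by rewrite (le_trans _ NB)// ler_wpM2r// lerDr.
have cE a : normc (c a) `^ p = B `^ p * t a `^ p.
  rewrite -powRM ?(ltW B0) ?divr_ge0 ?normc_ge0 ?(ltW B0)//.
  by rewrite mulrC divfK// gt_eqF.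
rewrite /lpnorm; under eq_bigr do rewrite cE.
rewrite -mulr_sumr powRM ?powR_ge0 ?sumr_ge0// => [|a _]; last exact: powR_ge0.
rewrite -powRrM mulfV ?gt_eqF// powRr1 ?(ltW B0)// mulrC ler_wpM2r ?(ltW B0)//.
apply: ge0_ler_powR; rewrite ?nnegrE ?invr_ge0 ?(ltW p0)//.
- by apply: sumr_ge0 => a _; exact: powR_ge0.
Qed.
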